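(* Let $\mathcal{U}$ be a metrically Ramsey ultrafilter on $\mathbb{N}$ such that some thin subset $T$ of $\mathbb{N}$ belongs to $\mathcal{U}$. Then there exists a mapping $\varphi:\mathbb{N}\to\omega$ such that the ultrafilter $\varphi(\mathcal{U})$ on $\omega$ is selective and $\varphi$ is finite-to-one on some member $U\in\mathcal{U}$.
   Context: $\mathbb{N}=\{1,2,3,\dots\}$ is endowed with the metric $d(x,y)=|x-y|$, and $\omega=\{0,1,2,\dots\}$. $[X]^2$ denotes the set of all two-element subsets of a set $X$. A mapping $\chi:[\mathbb{N}]^2\to\{0,1\}$ is an isometric coloring if $|x-y|=|z-t|$ implies $\chi(\{x,y\})=\chi(\{z,t\})$ for all $\{x,y\},\{z,t\}\in[\mathbb{N}]^2$. For a subset $U$, the set $[U]^2$ is $\chi$-monochrome if $\chi$ is constant on $[U]^2$. A free (i.e. non-principal) ultrafilter $\mathcal{U}$ on $\mathbb{N}$ is metrically Ramsey if for every isometric coloring $\chi$ of $[\mathbb{N}]^2$ there is $U\in\mathcal{U}$ such that $[U]^2$ is $\chi$-monochrome. A subset $T=\{t_n: n<\omega\}$ of $\mathbb{N}$ with $t_n<t_{n+1}$ for all $n$ is thin if $t_{n+1}-t_n\to\infty$ as $n\to\infty$. For a mapping $\varphi:\mathbb{N}\to\omega$, $\varphi(\mathcal{U})=\{A\subseteq\omega:\varphi^{-1}(A)\in\mathcal{U}\}$ is the image ultrafilter. A free ultrafilter $\mathcal{V}$ on an infinite set $X$ is selective if for every partition $\mathcal{P}$ of $X$ either $P\in\mathcal{V}$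 for some $P\in\mathcal{P}$ or there exists $V\in\mathcal{V}$ such that $|V\cap P|\leq1$ for each $P\in\mathcal{P}$ (equivalently, $\mathcal{V}$ is Ramsey: for every coloring $\chi:[X]^2\to\{0,1\}$ there is $V\in\mathcal{V}$ with $[V]^2$ $\chi$-monochrome). A mapping $\varphi$ is finite-to-one on $U$ if $\{x\in U:\varphi(x)=k\}$ is finite for every $k\in\omega$. *)

(* Defs.v *)
From mathcomp Require Import all_boot all_order all_algebra.
From mathcomp Require Import all_classical.

Set Implicit Arguments.
Unset Strict Implicit.
Unset Printing Implicit Defensive.

Local Open Scope classical_set_scope.

(* [nat] plays the role of omega; [posnat] of N = {1, 2, 3, ...}. *)
Notation posnat := {n : nat | 0 < n}.

Definition dist (x y : posnat) : nat := `|val x - val y|%N.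

Definition pairs (T : Type) (X : set T) : set (set T) :=
  [set A | exists x y, [/\ X x, X y, x <> y & A = [set x; y]]].

(* A coloring of [pairs setT] is given by a total function on [set posnat];
   its values outside [pairs setT] are never used. *)
Definition isometric_coloring (chi : set posnat -> bool) : Prop :=
  forall x y z t : posnat, x <> y -> z <> t ->
    dist x y = dist z t -> chi [set x; y] = chi [set z; t].

Definition monochrome (T : Type) (chi : set T -> bool) (X : set T) : Prop :=
  exists c : bool, forall A, pairs X A -> chi A = c.

Definition free_ultrafilter (T : Type) (F : set_system T) : Prop :=
  UltraFilter F /\ ~ (exists x : T, F = principal_filter x).

Definition metrically_Ramsey (F : set_system posnat) : Prop :=
  free_ultrafilter F /\
  forall chi : set posnat -> bool, isometric_coloring chi ->
    exists2 X, F X & monochrome chi X.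

(* The truncated subtraction below is exact since [t] is increasing. *)
Definition thin (T : set posnat) : Prop :=
  exists t : nat -> posnat,
    [/\ T = range t,
        forall n, val (t n) < val (t n.+1)
      & (val (t n.+1) - val (t n))%N @[n --> \oo] --> \oo].

Definition selective (T : Type) (F : set_system T) : Prop :=
  [/\ infinite_set [set: T],
      free_ultrafilter F
    & forall P : set (set T), partition P id [set: T] ->
        (exists2 A, P A & F A) \/
        (exists2 V, F V & forall A, P A -> is_subset1 (V `&` A))].

Definition finite_to_one_on (T S : Type) (f : T -> S) (X : set T) : Prop :=
  forall k : S, finite_set [set x | X x /\ f x = k].

(* Main.v *)
Require Import Defs.
From mathcomp Require Import all_boot all_order all_algebra.
From mathcomp Require Import all_classical.
From mathcomp Require Import zify.

Local Open Scope classical_set_scope.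

(** Cut a thin set into blocks [a_k, a_(k+1)) where (a_k) grows so fast that
    2 a_k < a_(k+1) and all gaps of the set beyond a_(k+1) are at least a_k. The
    ultrafilter contains either the union of the even blocks or the union of
    the odd ones; within that union, a difference y - x of points of distinct
    blocks determines x and y. Hence, with phi numbering the blocks of the union,
    a partition of omega induces an isometric coloring which records whether
    phi x and phi y belong to the same cell, and a monochrome member of the
    ultrafilter is mapped into one cell or meets each cell at most once. *)

(** Thinness freed from the enumeration and from truncated subtraction; only one threshold per gap
    size is needed later. *)
Definition sparse (S : set nat) : Prop :=
  forall m, exists a, forall x y, S x -> S y -> a <= x -> x < y -> x + m <= y.

Lemma thin_sparse (T : set posnat) : thin T -> sparse (val @` T).
Proof.
move=> [t [-> t_lt t_gap]] m.
have t_mono : {homo (fun n => val (t n)) : i j / i < j}.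
  exact: homo_ltn ltn_trans t_lt.
have [N _ gapN] : \forall n \near \oo, m <= val (t n.+1) - val (t n).
  by apply: (t_gap [set d | m <= d]); exists m.
exists (val (t N)) => _ _ [_ [i _ <-] <-] [_ [j _ <-] <-] tNi tij.
have leNi : N <= i by rewrite leqNgt; apply/negP => /t_mono; rewrite ltnNge tNi.
have ltij : i < j.
  rewrite ltnNge leq_eqVlt; apply/negP => /predU1P[eji|/t_mono].
    by rewrite eji ltnn in tij.
  by rewrite ltnNge (ltnW tij).
have lej : val (t i.+1) <= val (t j).
  by move: ltij; rewrite leq_eqVlt => /predU1P[->//|/t_mono/ltnW].
have := gapN i leNi; have := t_lt i; move: lej; rewrite /=; lia.
Qed.

Lemma sparse_blocks (S : set nat) : sparse S ->
  exists a : nat -> nat, [/\ a 0 = 0, forall k, 2 * a k < a k.+1 &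
    forall k x y, S x -> S y -> a k.+1 <= x -> x < y -> x + a k <= y].
Proof.
move=> /choice[s sP].
(* With [b] the previous cut point, [s b] is a threshold beyond which gaps are at least [b]; the
   [+ 1] makes the doubling strict. *)
pose a k := iter k (fun b => 2 * b + s b + 1) 0.
exists a; split=> // [k|k x y Sx Sy akx]; first by rewrite /a iterS; lia.
by apply: sP => //; move: akx; rewrite /a iterS; lia.
Qed.

Lemma block_index (a : nat -> nat) : a 0 = 0 -> (forall k, a k < a k.+1) ->
  exists f : nat -> nat, forall x, a (f x) <= x < a (f x).+1.
Proof.
move=> a0 a_lt; suff /choice[f fP] : forall x, exists k, a k <= x < a k.+1.
  by exists f.
elim=> [|x [k /andP[akx xak]]]; first by exists 0;
  rewrite a0 leqnn -[X in X < _]a0 a_lt.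
have [xk|kx] := ltnP x.+1 (a k.+1); first by exists k; rewrite xk (leq_trans akx).
by exists k.+1; rewrite kx /= (leq_ltn_trans xak).
Qed.

(* The parity conditions leave a whole block between the two points of a pair,
   as well as between the larger points of two pairs when their blocks differ. *)
Lemma sparse_sidon (S : set nat) : sparse S ->
  exists f : nat -> nat, [/\ forall k, exists n, forall x, f x = k -> x < n,
    forall x y, f x < f y -> x < y &
    forall x y x' y', S x -> S y -> S x' -> S y' ->
      odd (f x) = odd (f y) -> odd (f y) = odd (f y') ->
      odd (f x') = odd (f y') ->
      f x < f y -> f x' < f y' -> x + y' = x' + y -> x = x' /\ y = y'].
Proof.
move=> /sparse_blocks[a [a0 a_lt a_gap]].
have [|f fP] := @block_index a a0; first by move=> k; have := a_lt k; lia.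
have a_mono : {homo a : i j / i <= j}.
  by apply: homo_leq => // [j i k|i]; [apply: leq_trans | have := a_lt i; lia].
have parity_gap i j : odd i = odd j -> i < j -> i.+2 <= j by lia.
have below x k : (f x).+1 <= k -> x < a k.
  by move=> /a_mono; have /andP[_] := fP x; apply: leq_trans.
have above x k : k <= f x -> a k <= x.
  by move=> /a_mono h; have /andP[h' _] := fP x; apply: leq_trans h h'.
exists f; split=> [k|x y ltf|x y x' y' Sx Sy Sx' Sy' oxy oyy' oxy' ltxy ltxy' exy].
  by exists (a k.+1) => x <-; apply: below.
  exact: leq_trans (below _ _ ltf) (above _ _ (leqnn _)).
(* If [v'] lies in block k+1, then [u'] and [v] are both below [a k], so their sum is less than
   [a k.+1 <= v']. *)
have apart u v u' v' : odd (f v) = odd (f v') -> odd (f u') = odd (f v') ->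
    f u' < f v' -> f v < f v' -> u + v' = u' + v -> False.
  move=> ovv' ouv' ltu ltv e.
  have lt1 := parity_gap _ _ ouv' ltu; have lt2 := parity_gap _ _ ovv' ltv.
  case: (f v') lt1 lt2 (above v' (f v') (leqnn _)) => // k lt1 lt2 ak.
  have := below u' k lt1; have := below v k lt2; have := a_lt k; lia.
(* Two points of [S] in block k+1 differ by at least [a k]. This difference equals [u' - u], yet
   [u'] is below [a k]. *)
have close u v u' v' : S v -> S v' -> odd (f u') = odd (f v') ->
    f u' < f v' -> f v = f v' -> u + v' = u' + v -> v < v' -> False.
  move=> Sv Sv' ouv' ltuv' fvv' e ltvv'.
  have := parity_gap _ _ ouv' ltuv'; rewrite -fvv'.
  case: (f v) (above v (f v) (leqnn _)) => // k ak ltu.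
  have := below u' k ltu; have := a_gap k v v' Sv Sv' ak ltvv'; lia.
have efy : f y = f y'.
  case: (ltngtP (f y) (f y')) => // lt; exfalso.
    by apply: (apart x y x' y').
  by apply: (apart x' y' x y).
suff eyy' : y = y' by split=> //; lia.
case: (ltngtP y y') => // lt; exfalso.
  by apply: (close x y x' y').
by apply: (close x' y' x y).
Qed.

Lemma dist_set2 (x y z t : posnat) :
  [set x; y] = [set z; t] -> dist x y = dist z t.
Proof.
move=> /seteqP[st ts].
have := ts t (or_intror erefl); have := ts z (or_introl erefl).
have := st y (or_intror erefl); have := st x (or_introl erefl).
by move=> [->|->] [->|->] /= [e|e] [e'|e']; rewrite -?e -?e' // /dist distnC.
Qed.

(** Coloring a pair by whether its distance lies in [D] is isometric; [dist_set2] makes this color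
    depend on the unordered pair only. *)
Lemma metrically_Ramsey_dist (U : set_system posnat) (D : set nat) :
  metrically_Ramsey U ->
  exists2 X, U X &
    (forall x y, X x -> X y -> val x < val y -> D (val y - val x)) \/
    (forall x y, X x -> X y -> val x < val y -> ~ D (val y - val x)).
Proof.
move=> [_ ramsey].
pose chi A := `[< exists x y, A = [set x; y] /\ D (dist x y) >].
have chiE x y : chi [set x; y] = `[< D (dist x y) >].
  apply: asbool_equiv_eq; split=> [[z [t [/dist_set2 -> //]]]|Dxy].
  by exists x, y.
have [|X UX [c chic]] := ramsey chi.
  by move=> x y z t _ _ e; rewrite !chiE e.
have cP x y : X x -> X y -> val x < val y -> `[< D (val y - val x) >] = c.
  move=> Xx Xy ltxy; rewrite -(chic [set x; y]) ?chiE /dist.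
    by congr `[< D _ >]; lia.
  by exists x, y; split=> // exy; rewrite exy ltnn in ltxy.
exists X => //; case: c cP {chic} => cP; [left | right] => x y Xx Xy ltxy.
  exact/asboolP/cP.
by have := cP x y Xx Xy ltxy => /asboolP.
Qed.

Lemma ultra_setVsetC (T : Type) (F : set_system T) : ProperFilter F ->
  (forall A, F A \/ F (~` A)) -> UltraFilter F.
Proof.
move=> FF FC; split=> // G GG sFG; apply/seteqP; split=> // A GA.
have [//|/sFG GAC] := FC A; exfalso.
by apply: (@filter_not_empty _ G); rewrite -(setICr A); apply: filterI.
Qed.

Lemma fmap_ultra (T S : Type) (f : T -> S) (F : set_system T) :
  UltraFilter F -> UltraFilter (f @ F).
Proof.
move=> UF; apply: ultra_setVsetC => A.
exact: (@in_ultra_setVsetC _ F (f @^-1` A)).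
Qed.

Lemma ultra_set1 (T : Type) (F : set_system T) (x : T) :
  UltraFilter F -> F [set x] -> F = principal_filter x.
Proof.
move=> UF Fx; have PF := principal_filter_proper x.
apply/esym/max_filter => A FA; apply/principal_filterP.
by have [y [Ay <-]] := filter_ex (filterI FA Fx).
Qed.

(** A free ultrafilter contains the complement of every point, so a finite member could be
    intersected down to the empty set. *)
Lemma free_ultra_infinite (T : choiceType) (F : set_system T) (A : set T) :
  free_ultrafilter F -> F A -> infinite_set A.
Proof.
move=> [UF nprinc] FA /finite_fsetP[D AD].
have FC x : F (~` [set x]).
  have [Fx|//] := in_ultra_setVsetC [set x] UF.
  by exfalso; apply: nprinc; exists x; apply: ultra_set1.
have FD : F (\bigcap_(x in A) ~` [set x]).
  by rewrite AD; apply: filter_bigI (fun x _ => FC x).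
have [x [Ax Dx]] := filter_ex (filterI FA FD).
by apply: (Dx x).
Qed.

Lemma fmap_free_ultra (T : choiceType) (S : Type) (f : T -> S)
    (F : set_system T) (X : set T) :
  free_ultrafilter F -> F X -> finite_to_one_on f X ->
  free_ultrafilter (f @ F).
Proof.
move=> freeF FX fin_f; have [UF _] := freeF; split; first exact: fmap_ultra.
(* If the image were principal at [k], the fibre over [k] within [X], which is finite, would belong
   to [F]. *)
move=> [k fk]; have : (f @ F) [set k] by rewrite fk; apply/principal_filterP.
move=> Fk; apply: (free_ultra_infinite _ _ (X `&` f @^-1` [set k]) freeF).
  exact: filterI.
exact: fin_f.
Qed.

Theorem proposition3p2 (U : set_system posnat)
    (hU : metrically_Ramsey U)
    (hT : exists2 T : set posnat, thin T & U T) :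
  exists phi : posnat -> nat,
    selective (phi @ U) /\
    (exists2 X, U X & finite_to_one_on phi X).
Proof.
have [freeU _] := hU; have [UU _] := freeU; have [T thinT UT] := hT.
have [f [f_fin f_lt f_sidon]] := sparse_sidon _ (thin_sparse _ thinT).
(* Halving numbers the blocks of either parity consecutively. *)
pose phi (x : posnat) := (f (val x))./2.
have phi_fin X : finite_to_one_on phi X.
  (* The fibre of [phi] over [k] consists of the blocks 2k and 2k+1, both bounded. *)
  move=> k; have [n0 n0P] := f_fin k.*2; have [n1 n1P] := f_fin k.*2.+1.
  apply: (@sub_finite_set _ _ (val @^-1` `I_(n0 + n1))).
    move=> x [_ phix] /=; have := odd_double_half (f (val x)).
    rewrite -/(phi x) phix; case: odd => /esym e.
      by apply: leq_trans (n1P _ e) (leq_addl _ _).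
    by apply: leq_trans (n0P _ e) (leq_addr _ _).
  by apply: finite_preimage (finite_II _) => x y _ _; apply: val_inj.
exists phi; split; last by exists T.
split; [exact: infinite_nat | exact: (fmap_free_ultra _ _ _ _ T) |].
move=> P [coverP trivP neP].
have [b Ub] : exists b, U [set x | odd (f (val x)) = b].
  have [|/filterS Uc] := in_ultra_setVsetC [set x | odd (f (val x)) = true] UU.
    by exists true.
  by exists false; apply: Uc => x /=; case: odd.
pose E := T `&` [set x | odd (f (val x)) = b].
have UE : U E by apply: filterI.
pose same i j := exists2 A, P A & A i /\ A j.
pose D d := exists x y, [/\ E x, E y, f (val x) < f (val y),
  val x + d = val y & same (phi x) (phi y)].
have DE x y : E x -> E y -> f (val x) < f (val y) ->
    D (val y - val x) <-> same (phi x) (phi y).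
  move=> Ex Ey ltf; have ltxy := f_lt _ _ ltf; split=> [|sxy]; last first.
    by exists x, y; split=> //; rewrite subnKC // ltnW.
  (* The pair witnessing [D] has the same difference as [x], [y], and all four points lie in blocks
     of parity [b], so [f_sidon] identifies the two pairs. *)
  move=> [x' [y' [Ex' Ey' ltf' e]]].
  have [Tx fx] := Ex; have [Ty fy] := Ey; have [Tx' fx'] := Ex'.
  have [Ty' fy'] := Ey'; move: fx fy fx' fy' => /= fx fy fx' fy'.
  have [] : val x = val x' /\ val y = val y'.
    by apply: f_sidon; rewrite ?fx ?fy ?fx' ?fy' //; try exact: imageP; lia.
  by move=> /val_inj -> /val_inj ->.
have [X UX XD] := metrically_Ramsey_dist _ D hU.
have UXE : U (X `&` E) by apply: filterI.
have phi_eq x y : f (val x) = f (val y) -> phi x = phi y.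
  by move=> e; rewrite /phi e.
(* Either any two blocks met by [X] within [E] go to a common cell, and the cell of one point is
   then in the image ultrafilter, or distinct blocks go to distinct cells. Points of one block
   always share their [phi] value. *)
case: XD => XD; [left | right].
  have [x [Xx Ex]] := filter_ex UXE.
  have [A PA Ax] : exists2 A, P A & A (phi x).
    by have : [set: nat] (phi x) by []; rewrite -coverP.
  exists A => //; suff: X `&` E `<=` phi @^-1` A by move/filterS; apply.
  move=> y [Xy Ey] /=.
  have same_in i : same i (phi y) \/ same (phi y) i -> A i -> A (phi y).
    by case=> [] [B PB [Bi Bj]] Ai; rewrite (trivP A B) //; exists i.
  apply: (same_in (phi x)) => //; case: (ltngtP (f (val x)) (f (val y))) => ltf.
  - by left; apply/DE => //; apply: XD => //; apply: f_lt.
  - by right; apply/DE => //; apply: XD => //; apply: f_lt.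
  - by left; exists A => //; rewrite -(phi_eq x y ltf).
exists (phi @` (X `&` E)).
  suff: X `&` E `<=` phi @^-1` (phi @` (X `&` E)) by move/filterS; apply.
  by move=> x XEx; exists x.
move=> A PA _ _ [[x [Xx Ex] <-] Ax] [[y [Xy Ey] <-] Ay].
case: (ltngtP (f (val x)) (f (val y))) => [ltf|ltf|]; last exact: phi_eq.
- exfalso; apply: (XD x y) => //; first exact: f_lt.
  by apply/DE => //; exists A.
- exfalso; apply: (XD y x) => //; first exact: f_lt.
  by apply/DE => //; exists A.
Qed.
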